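(* Let $b$ be a locally finite graph over a countable discrete set $X$. Let $m \geq 1$ be an integer and let $V, f\in C(X)$ with $\Delta^k f > 0$ on $X$ for all $0\leq k\leq m$. Then for any $u\in C_c(X)$, $$\begin{aligned} & \sum_{x\in X} V(x)|\nabla(\Delta^m u)|^2(x) - \sum_{x\in X}\frac{\Delta^m \mathscr{T}(V,\Delta^mf)(x)}{f(x)}\,u(x)^2\\ & = \sum_{k=0}^{m-1}\sum_{x\in X}\frac{\Delta^{m-1-k}\mathscr{T}(V,\Delta^mf)}{\Delta^{k+1}f}(x)\left|\Delta^{k+1}u-L(\Delta^k f)\,\Delta^k u\right|^2(x) \\ & \quad + 2 \sum_{k=0}^{m-1}\mathscr{R}\left(\frac{\Delta^{m-1-k}\mathscr{T}(V,\Delta^mf)}{\Delta^k f},\,\Delta^k f,\, \Delta^k u\right)+\mathscr{R}\left(V,\, \Delta^mf,\, \Delta^m u\right). \end{aligned}$$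
   Context: A graph over a countable discrete set $X$ is a symmetric function $b:X\times X\to[0,\infty)$ vanishing on the diagonal; $x\sim y$ means $b(x,y)>0$; the graph is locally finite if every $x\in X$ has finitely many neighbors. $C(X)$ is the space of real functions on $X$ and $C_c(X)$ the finitely supported ones. The Laplacian is $\Delta u(x)=\sum_{y\sim x} b(x,y)[u(x)-u(y)]$, and $\Delta^k$ is its $k$-fold iterate ($\Delta^0=\mathrm{Id}$). For $g,h\in C(X)$, $\langle\nabla g,\nabla h\rangle_x:=\frac12\sum_{y\sim x}b(x,y)[g(x)-g(y)][h(x)-h(y)]$ and $|\nabla g|^2(x):=\langle\nabla g,\nabla g\rangle_x$. For $W,g\in C(X)$, $\mathscr{T}(W,g)(x):=W(x)\Delta g(x)-\langle\nabla g,\nabla W\rangle_x$. For positive $g\in C(X)$, $L(g):=\frac{\Delta g}{g}$. For $W\in C(X)$, positive $g\in C(X)$ and $v\in C_c(X)$, $$\mathscr{R}(W,g,v):=\frac12\sum_{x,y\in X} b(x,y)\,W(x)\left(\sqrt{\frac{g(x)}{g(y)}}\,v(y)-\sqrt{\frac{g(y)}{g(x)}}\,v(x)\right)^2.$$ *)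

(* Defs.v *)
From HB Require Import structures.
From mathcomp Require Import all_boot all_order all_algebra.
From mathcomp Require Import boolp classical_sets functions cardinality fsbigop.
From mathcomp Require Import reals.
Set Implicit Arguments.
Unset Strict Implicit.
Unset Printing Implicit Defensive.
Import Order.TTheory GRing.Theory Num.Theory.
Local Open Scope classical_set_scope.
Local Open Scope ring_scope.

Record graph (R : realType) (X : countType) := Graph {
  weight :> X -> X -> R;
  weight_ge0 : forall x y, 0 <= weight x y;
  weight_sym : forall x y, weight x y = weight y x;
  weight_diag : forall x, weight x x = 0 }.

Definition neighbors (R : realType) (X : countType) (b : graph R X) (x : X) :
  set X := [set y | 0 < b x y].

Definition locally_finite (R : realType) (X : countType) (b : graph R X) :=
  forall x, finite_set (neighbors b x).

Definition finitely_supported (R : realType) (X : countType) (u : X -> R) :=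
  finite_set [set x | u x != 0].

(* [\sum_(i \in A) F i] is 0 when F has infinite support on A. On a locally
   finite graph the sums below over [neighbors b x] are finite, and the lemmas
   at the end of the file show that the sums over X and X * X have finite
   support for finitely supported functions, so that value is never reached. *)
Definition laplacian (R : realType) (X : countType) (b : graph R X)
    (u : X -> R) : X -> R :=
  fun x => \sum_(y \in neighbors b x) b x y * (u x - u y).

Definition grad_prod (R : realType) (X : countType) (b : graph R X)
    (g h : X -> R) : X -> R :=
  fun x => 2^-1 *
    \sum_(y \in neighbors b x) b x y * (g x - g y) * (h x - h y).

Definition grad_sq (R : realType) (X : countType) (b : graph R X)
    (g : X -> R) : X -> R := grad_prod b g g.

Definition opT (R : realType) (X : countType) (b : graph R X)
    (W g : X -> R) : X -> R :=
  fun x => W x * laplacian b g x - grad_prod b g W x.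

Definition opL (R : realType) (X : countType) (b : graph R X)
    (g : X -> R) : X -> R :=
  fun x => laplacian b g x / g x.

Definition remainder (R : realType) (X : countType) (b : graph R X)
    (W g v : X -> R) : R :=
  2^-1 * \sum_(p \in [set: X * X])
    b p.1 p.2 * W p.1 *
    (Num.sqrt (g p.1 / g p.2) * v p.2 - Num.sqrt (g p.2 / g p.1) * v p.1) ^+ 2.

Section FiniteSupport.
Variables (R : realType) (X : countType) (b : graph R X).
Hypothesis lfb : locally_finite b.

Lemma weight_gt0 x y : (0 < b x y) = (b x y != 0).
Proof. by rewrite lt_neqAle weight_ge0 andbT eq_sym. Qed.

Lemma finite_neighborhood (u : X -> R) : finitely_supported u ->
  finite_set [set x | u x != 0 \/ exists2 y, neighbors b x y & u y != 0].
Proof.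
move=> fu; apply: (@sub_finite_set _ _
  ([set x | u x != 0] `|` \bigcup_(y in [set y | u y != 0]) neighbors b y)).
  move=> x [ux|[y xy uy]]; first by left.
  by right; exists y => //; rewrite /neighbors /= weight_sym.
rewrite finite_setU; split=> //.
by apply: bigcup_finite => // y _; exact: lfb.
Qed.

Lemma finitely_supported_local (u v : X -> R) : finitely_supported u ->
  (forall x, u x = 0 -> (forall y, neighbors b x y -> u y = 0) -> v x = 0) ->
  finitely_supported v.
Proof.
move=> fu uv; apply: sub_finite_set (finite_neighborhood fu) => x /= vx.
have [ux|ux] := eqVneq (u x) 0; [right|by left].
apply: contrapT => H; move/eqP: vx; apply; apply: uv => // y xy.
by apply/eqP; apply: contra_notT H => uy; exists y.
Qed.

Lemma finitely_supported_laplacian (u : X -> R) :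
  finitely_supported u -> finitely_supported (laplacian b u).
Proof.
move=> fu; apply: (finitely_supported_local fu) => x ux uy.
by apply: fsbig1 => y xy; rewrite ux (uy _ xy) subr0 mulr0.
Qed.

Lemma finitely_supported_iter_laplacian k (u : X -> R) :
  finitely_supported u -> finitely_supported (iter k (laplacian b) u).
Proof.
by move=> fu; elim: k => //= k; exact: finitely_supported_laplacian.
Qed.

Lemma finitely_supported_grad_sq (u : X -> R) :
  finitely_supported u -> finitely_supported (grad_sq b u).
Proof.
move=> fu; apply: (finitely_supported_local fu) => x ux uy.
rewrite /grad_sq /grad_prod fsbig1 ?mulr0// => y xy.
by rewrite ux (uy _ xy) subr0 mulr0.
Qed.

Lemma finite_support_remainder (W g v : X -> R) : finitely_supported v ->
  finite_set [set p : X * X | b p.1 p.2 * W p.1 *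
    (Num.sqrt (g p.1 / g p.2) * v p.2 -
     Num.sqrt (g p.2 / g p.1) * v p.1) ^+ 2 != 0].
Proof.
move=> fv; have fN := finite_neighborhood fv.
apply: sub_finite_set (finite_setX fN fN) => -[x y] /=.
have [->|bxy] := eqVneq (b x y) 0; first by rewrite !mul0r eqxx.
have nxy : neighbors b x y by rewrite /neighbors /= weight_gt0.
have nyx : neighbors b y x by rewrite /neighbors /= weight_sym weight_gt0.
have [vx|vx] := eqVneq (v x) 0; last by move=> _; split; [left|right; exists x].
have [vy|vy] := eqVneq (v y) 0; last by move=> _; split; [right; exists y|left].
by rewrite vx vy !mulr0 subr0 expr0n mulr0 eqxx.
Qed.

End FiniteSupport.

(* Main.v *)
(* Every sum involved reduces to a finite sum over directed edges, and two such
   sums agree as soon as their summands agree after symmetrisation in the two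
   endpoints.  This gives, for [g > 0] and [v] finitely supported,
     sum V |grad v|^2 - sum T(V,g)/g v^2 = R(V,g,v)
   and, if moreover [Delta g > 0],
     sum W/(Delta g) (Delta v)^2 - sum (Delta W)/g v^2
       = sum W/(Delta g) |Delta v - L(g) v|^2 + 2 R(W/g,g,v).
   With [g = Delta^k f], [v = Delta^k u] and [W = Delta^(m-1-k) T], the left-hand
   sides of the second identity telescope over [k < m], and the first identity
   closes the sum at [k = m]. *)
Require Import Defs.
From mathcomp Require Import all_boot all_order all_algebra.
From mathcomp Require Import boolp classical_sets functions cardinality fsbigop.
From mathcomp Require Import reals.
From mathcomp Require Import ring lra.
Import Order.TTheory GRing.Theory Num.Theory.
Local Open Scope classical_set_scope.
Local Open Scope ring_scope.

(** Both sums are narrowed to the union of the two supports. Finiteness matters because a sum with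
    infinite support is 0 by convention, which would break additivity. *)
Lemma fsumrD_finite_support (R : idomainType) (I : choiceType) (F G : I -> R) :
  finite_set [set i | F i != 0] -> finite_set [set i | G i != 0] ->
  \sum_(i \in [set: I]) (F i + G i) =
  \sum_(i \in [set: I]) F i + \sum_(i \in [set: I]) G i.
Proof.
move=> fF fG; set S := [set i | F i != 0] `|` [set i | G i != 0].
have widen (H : I -> R) : (forall i, ~ S i -> H i = 0) ->
    \sum_(i \in S) H i = \sum_(i \in [set: I]) H i.
  by move=> H0; apply: fsbig_widen => // i [_ /H0].
have F0 i : ~ S i -> F i = 0.
  by move=> Si; apply/eqP; apply: contra_notT Si => Fi; left.
have G0 i : ~ S i -> G i = 0.
  by move=> Si; apply/eqP; apply: contra_notT Si => Gi; right.
rewrite -!widen // ?fsbig_split ?finite_setU // => i Si.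
by rewrite F0 // G0 // addr0.
Qed.

Section EdgeSums.
Set Implicit Arguments.
Unset Strict Implicit.
Variables (R : realType) (X : countType) (b : graph R X).
Hypothesis lfb : locally_finite b.
Variable v : X -> R.
Hypothesis fv : finitely_supported v.
Implicit Types K : X -> X -> R.

Definition edge_sum K := \sum_(p \in [set: X * X]) b p.1 p.2 * K p.1 p.2.

(** Confines [K] to pairs meeting the support of [v]. By local finiteness only finitely many edges
    do so, and all their endpoints lie in the finite set [N] below. *)
Definition edge_local K := forall x y, v x = 0 -> v y = 0 -> K x y = 0.

Let N := [set x | v x != 0 \/ exists2 y, neighbors b x y & v y != 0].

Let edge_localN K x y : edge_local K -> ~ (N x /\ N y) -> b x y * K x y = 0.
Proof.
move=> locK Nxy; have [->|bxy] := eqVneq (b x y) 0; first by rewrite mul0r.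
have nxy : neighbors b x y by rewrite /neighbors /= weight_gt0.
have nyx : neighbors b y x by rewrite /neighbors /= weight_sym weight_gt0.
rewrite locK ?mulr0 //; apply/eqP; apply: contra_notT Nxy => vN0.
  by split; [left|right; exists x].
by split; [right; exists y|left].
Qed.

Lemma finite_support_edge K : edge_local K ->
  finite_set [set p : X * X | b p.1 p.2 * K p.1 p.2 != 0].
Proof.
move=> locK; have fN : finite_set N by exact: finite_neighborhood.
apply: sub_finite_set (finite_setX fN fN) => -[x y] /= bK.
by apply: contrapT => Nxy; move: bK; rewrite edge_localN // eqxx.
Qed.

Lemma edge_sumD K K' : edge_local K -> edge_local K' ->
  edge_sum (fun x y => K x y + K' x y) = edge_sum K + edge_sum K'.
Proof.
move=> locK locK'; rewrite /edge_sum -fsumrD_finite_support.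
- by apply: eq_fsbigr => p _; rewrite mulrDr.
- exact: finite_support_edge.
- exact: finite_support_edge.
Qed.

Lemma edge_sum_swap K : edge_sum (fun x y => K y x) = edge_sum K.
Proof.
rewrite /edge_sum (@reindex_fsbigT _ _ _ _ _ (fun p : X * X => (p.2, p.1))) /=.
  by apply: eq_fsbigr => p _; rewrite weight_sym.
by exists (fun p : X * X => (p.2, p.1)) => -[].
Qed.

(** Since [b] is symmetric, swapping the endpoints preserves an edge sum, so its double is the edge
    sum of the symmetrised kernel. *)
Lemma eq_edge_sum_sym K K' : edge_local K -> edge_local K' ->
  (forall x y, K x y + K y x = K' x y + K' y x) -> edge_sum K = edge_sum K'.
Proof.
move=> locK locK' eqK.
have sym H : edge_local H ->
    edge_sum H + edge_sum H = edge_sum (fun x y => H x y + H y x).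
  move=> locH; rewrite (edge_sumD locH (K' := fun x y => H y x)).
    by rewrite (edge_sum_swap H).
  by move=> x y vx vy; apply: locH.
have : edge_sum K + edge_sum K = edge_sum K' + edge_sum K'.
  by rewrite !sym //; congr edge_sum; apply/funext => x; apply/funext => y.
lra.
Qed.

(** Both sides reduce to the finite set [N * N], where the iterated sum is a sum over pairs: [b]
    vanishes off the neighbors and [b x y * K x y] off [N * N]. *)
Lemma vertex_sumE K : edge_local K ->
  \sum_(x \in [set: X]) \sum_(y \in neighbors b x) b x y * K x y = edge_sum K.
Proof.
move=> locK; have fN : finite_set N by exact: finite_neighborhood.
have nbrE x : \sum_(y \in neighbors b x) b x y * K x y =
              \sum_(y \in N) b x y * K x y.
  rewrite (@fsbig_widen _ _ _ _ (neighbors b x) setT) //; last first.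
    move=> y [_ /= /negP]; rewrite weight_gt0 negbK => /eqP ->.
    by rewrite mul0r.
  apply/esym/fsbig_widen => // y [_ Ny] /=.
  by apply: edge_localN => // -[].
under eq_fsbigr do rewrite nbrE.
rewrite -(@fsbig_widen _ _ _ _ N setT) //; last first.
  by move=> x [_ Nx]; apply: fsbig1 => y _; apply: edge_localN => // -[].
rewrite pair_fsbig //; apply: fsbig_widen => // -[x y] [_ /= Nxy].
exact: edge_localN.
Qed.

End EdgeSums.

Section Remainder.
Set Implicit Arguments.
Unset Strict Implicit.
Variables (R : realType) (X : countType) (b : graph R X).
Hypothesis lfb : locally_finite b.

(** The two square roots are reciprocal, so the cross term is free of them. *)
Lemma sqr_sqrt_divB (a c p q : R) : 0 < a -> 0 < c ->
  (Num.sqrt (a / c) * p - Num.sqrt (c / a) * q) ^+ 2 =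
  a / c * p ^+ 2 + c / a * q ^+ 2 - 2 * p * q.
Proof.
move=> a0 c0; rewrite sqrrB !exprMn !sqr_sqrtr ?divr_ge0 ?ltW //.
have -> : Num.sqrt (a / c) * p * (Num.sqrt (c / a) * q) = p * q.
  rewrite mulrACA -sqrtrM ?divr_ge0 ?ltW //.
  by rewrite [a / c * _]mulrA divfK ?gt_eqF // divff ?gt_eqF // sqrtr1 mul1r.
ring.
Qed.

Lemma remainder_edge_sum (W g v : X -> R) : (forall x, 0 < g x) ->
  remainder b W g v = edge_sum b (fun x y => 2^-1 * W x *
    (g x / g y * v y ^+ 2 + g y / g x * v x ^+ 2 - 2 * v y * v x)).
Proof.
move=> g0; rewrite /remainder mulr_fsumr; apply: eq_fsbigr => -[x y] _ /=.
rewrite sqr_sqrt_divB //; ring.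
Qed.

Lemma hardy_grad_identity (V g v : X -> R) :
  (forall x, 0 < g x) -> finitely_supported v ->
  \sum_(x \in [set: X]) V x * grad_sq b v x
    - \sum_(x \in [set: X]) opT b V g x / g x * v x ^+ 2 = remainder b V g v.
Proof.
move=> g0 fv; apply/eqP; rewrite subr_eq; apply/eqP.
pose A x y := 2^-1 * V x * (v x - v y) ^+ 2.
(* Expanding [opT] gives [V x - 2^-1 * (V x - V y)] as the factor of [g x - g y], hence the mean of
   [V x] and [V y]. *)
pose B x y := 2^-1 * (V x + V y) * (g x - g y) / g x * v x ^+ 2.
have locA : edge_local v A by move=> x y vx vy; rewrite /A vx vy; ring.
have locB : edge_local v B by move=> x y vx vy; rewrite /B vx; ring.
have -> : \sum_(x \in [set: X]) V x * grad_sq b v x = edge_sum b A.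
  rewrite -(vertex_sumE lfb fv locA); apply: eq_fsbigr => x _.
  rewrite /grad_sq /grad_prod mulrA mulr_fsumr.
  by apply: eq_fsbigr => y _; rewrite /A; ring.
have -> : \sum_(x \in [set: X]) opT b V g x / g x * v x ^+ 2 = edge_sum b B.
  rewrite -(vertex_sumE lfb fv locB); apply: eq_fsbigr => x _.
  rewrite /opT /laplacian /grad_prod -mulNr !mulr_fsumr -fsbig_split //.
  rewrite !mulr_fsuml; apply: eq_fsbigr => y _.
  by rewrite /B /=; field; rewrite gt_eqF.
rewrite remainder_edge_sum // -(edge_sumD lfb fv) //; last first.
  by move=> x y vx vy; rewrite vx vy; ring.
apply: (eq_edge_sum_sym lfb fv) => //.
  by move=> x y vx vy; rewrite locB // vx vy; ring.
by move=> x y; rewrite /A /B; field; rewrite !gt_eqF.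
Qed.

Lemma hardy_laplacian_identity (W g v : X -> R) :
  (forall x, 0 < g x) -> (forall x, 0 < laplacian b g x) ->
  finitely_supported v ->
  \sum_(x \in [set: X]) W x / laplacian b g x * laplacian b v x ^+ 2
    - \sum_(x \in [set: X]) laplacian b W x / g x * v x ^+ 2 =
  \sum_(x \in [set: X]) W x / laplacian b g x *
      `|laplacian b v x - opL b g x * v x| ^+ 2
    + 2 * remainder b (fun x => W x / g x) g v.
Proof.
move=> g0 Lg0 fv; apply/eqP; rewrite subr_eq; apply/eqP.
(* With [L = opL b g x], completing the square in [laplacian b v x] leaves [2 * L * v x * laplacian
   b v x - L ^+ 2 * v x ^+ 2]. Multiplying by [W x / laplacian b g x] cancels the denominator, and
   [A] is the edge kernel of the result. *)
pose A x y := 2 * W x / g x * v x * (v x - v y)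
              - W x / g x ^+ 2 * (g x - g y) * v x ^+ 2.
pose B x y := (W x - W y) / g x * v x ^+ 2.
have locA : edge_local v A by move=> x y vx vy; rewrite /A vx; ring.
have locB : edge_local v B by move=> x y vx vy; rewrite /B vx; ring.
pose E x := \sum_(y \in neighbors b x) b x y * A x y.
have EE x : E x = 2 * W x / g x * v x * laplacian b v x
                - W x / g x ^+ 2 * v x ^+ 2 * laplacian b g x.
  rewrite /laplacian -mulNr !mulr_fsumr -fsbig_split //.
  by apply: eq_fsbigr => y _; rewrite /A /=; ring.
pose S x := W x / laplacian b g x * `|laplacian b v x - opL b g x * v x| ^+ 2.
have -> : \sum_(x \in [set: X]) W x / laplacian b g x * laplacian b v x ^+ 2 =
          \sum_(x \in [set: X]) S x + edge_sum b A.
  rewrite -(vertex_sumE lfb fv locA) -[X in _ + X]/(\sum_(x \in [set: X]) E x).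
  rewrite -fsumrD_finite_support.
  - apply: eq_fsbigr => x _; rewrite EE /S /opL real_normK ?num_real //.
    by field; rewrite !gt_eqF.
  - apply: (finitely_supported_local lfb fv) => x vx vy.
    have Lv : laplacian b v x = 0.
      by apply: fsbig1 => y xy; rewrite vx vy // subr0 mulr0.
    by rewrite /S vx Lv mulr0 subr0 normr0 expr0n mulr0.
  - apply: sub_finite_set fv => x /=; apply: contra_neq => vx.
    by rewrite EE vx; ring.
have -> : \sum_(x \in [set: X]) laplacian b W x / g x * v x ^+ 2 = edge_sum b B.
  rewrite -(vertex_sumE lfb fv locB); apply: eq_fsbigr => x _.
  rewrite /laplacian !mulr_fsuml.
  by apply: eq_fsbigr => y _; rewrite /B; ring.
rewrite remainder_edge_sum // -addrA; congr (_ + _).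
rewrite mulr_natl mulr2n -!(edge_sumD lfb fv);
  try by move=> x y vx vy; rewrite ?locB // vx vy; ring.
apply: (eq_edge_sum_sym lfb fv) => //.
  by move=> x y vx vy; rewrite locB // vx vy; ring.
(* [A] minus the kernel of the doubled remainder is [W x * (v x ^+ 2 / g x - v y ^+ 2 / g y)], whose
   symmetrisation is that of [B]: Green's formula for [W] and [v ^+ 2 / g]. *)
by move=> x y; rewrite /A /B; field; rewrite !gt_eqF.
Qed.

End Remainder.

Theorem theorem2p4 (R : realType) (X : countType) (b : graph R X)
  (hb : locally_finite b) (m : nat) (hm : (1 <= m)%N) (V f : X -> R)
  (hf : forall k : nat, (k <= m)%N -> forall x : X, 0 < iter k (laplacian b) f x)
  (u : X -> R) (hu : finitely_supported u) :
  let D := fun (k : nat) (w : X -> R) => iter k (laplacian b) w in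
  let T := opT b V (D m f) in
  \sum_(x \in [set: X]) V x * grad_sq b (D m u) x
    - \sum_(x \in [set: X]) D m T x / f x * u x ^+ 2
  = \sum_(0 <= k < m) \sum_(x \in [set: X])
      D (m - 1 - k)%N T x / D k.+1 f x
        * `|D k.+1 u x - opL b (D k f) x * D k u x| ^+ 2
    + 2 * \sum_(0 <= k < m)
        remainder b (fun x => D (m - 1 - k)%N T x / D k f x) (D k f) (D k u)
    + remainder b V (D m f) (D m u).
Proof.
move=> D T.
pose S k := \sum_(x \in [set: X]) D (m - k)%N T x / D k f x * D k u x ^+ 2.
rewrite mulr_sumr -big_split /=.
have step k : (0 <= k < m)%N ->
    \sum_(x \in [set: X]) D (m - 1 - k)%N T x / D k.+1 f x
        * `|D k.+1 u x - opL b (D k f) x * D k u x| ^+ 2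
      + 2 * remainder b (fun x => D (m - 1 - k)%N T x / D k f x) (D k f) (D k u)
    = S k.+1 - S k.
  move=> /andP[_ km]; rewrite -hardy_laplacian_identity //.
  (* As [k < m], one more Laplacian turns the exponent [m - 1 - k] into [m - k]. *)
  - by rewrite /S -subnDA add1n -(subnSK km).
  - by apply: hf; exact: ltnW.
  - by move=> x; exact: (hf k.+1 km).
  - exact: finitely_supported_iter_laplacian.
rewrite (eq_big_nat _ _ step) telescope_sumr // /S subnn subn0.
(* Telescoping leaves [S m - S 0]. [S 0] is the term subtracted on the left of the goal, and [S m]
   cancels the term subtracted in the gradient identity. *)
rewrite -hardy_grad_identity //.
- by rewrite /=; lra.
- exact: hf.
- exact: finitely_supported_iter_laplacian.
Qed.
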